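(* Uniformly for all $n\ge 1$ and $0\le p<n^{-1}$, $$\mathbb{E}\,\chi(G(n,p))=\frac{1}{1-np}\Bigl(1+O\Bigl(\frac{1}{n(1-np)^3}\Bigr)\Bigr),$$ $$\operatorname{Var}\chi(G(n,p))=O\Bigl(\frac{1}{n(1-np)^5}\Bigr),$$ and $$\chi(G(n,p))=\frac{1}{1-np}\Bigl(1+O_{\mathrm p}\bigl((n(1-np)^3)^{-1/2}\bigr)\Bigr).$$ In particular, if $p=p(n)<n^{-1}$ satisfies $1-np\gg n^{-1/3}$ (i.e. $n^{1/3}(1-np)\to\infty$ as $n\to\infty$), then $(1-np)\,\chi(G(n,p))\to 1$ in probability as $n\to\infty$.
   Context: $G(n,p)$ is the Erdős–Rényi random graph on $n$ vertices in which each possible edge is present independently with probability $p$. For a graph $G$ on $n$ vertices with connected components $\mathcal C_1,\dots,\mathcal C_K$, the susceptibility is $\chi(G)=\frac1n\sum_{i=1}^K|\mathcal C_i|^2$ (the mean size of the component containing a uniformly random vertex). The constants implicit in $O$ are absolute. $X=O_{\mathrm p}(a)$, for families of random variables $X=X_{n,p}$ and positive numbers $a=a_{n,p}$, means (uniformly) that for every $\varepsilon>0$ there is a constant $C_\varepsilon$ such that $\mathbb P(|X_{n,p}|>C_\varepsilon a_{n,p})<\varepsilon$ for all $n,p$ in the stated range. *)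

(* Defs.v *)
From HB Require Import structures.
From mathcomp Require Import all_boot all_order all_algebra.
From mathcomp Require Import finmap.
From mathcomp Require Import all_classical all_reals all_analysis.

Set Implicit Arguments.
Unset Strict Implicit.
Unset Printing Implicit Defensive.

Import Order.TTheory GRing.Theory Num.Theory.
Import numFieldNormedType.Exports.

Local Open Scope ring_scope.

(* Simple graphs on the vertex set {0, ..., n-1}: a graph is an arbitrary set
   of edges, an edge being a set of exactly two vertices. *)
Definition edge (n : nat) : finType := {e : {set 'I_n} | #|e| == 2%N}.

Definition graph (n : nat) : Type := {set edge n}.

HB.instance Definition _ (n : nat) := Finite.on (graph n).
HB.instance Definition _ (n : nat) :=
  isPointed.Build (graph n) (finset.set0 : {set edge n}).
HB.instance Definition _ (n : nat) :=
  @isMeasurable.Build default_measure_display (graph n) discrete_measurable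
    discrete_measurable0 discrete_measurableC discrete_measurableU.

Definition edges (n : nat) (G : graph n) : {set edge n} := G.

(* Irreflexive, since #|[set x; x]| = 1. *)
Definition adj (n : nat) (G : graph n) : rel 'I_n :=
  fun x y => [exists e in edges G, val e == [set x; y]%SET].

Definition components (n : nat) (G : graph n) : {set {set 'I_n}} :=
  equivalence_partition (connect (adj G)) [set: 'I_n]%SET.

Definition susceptibility (R : realType) (n : nat) (G : graph n) : R :=
  n%:R^-1 * \sum_(C in components G) #|C|%:R ^+ 2.

Definition gnp_pmf (R : realType) (n : nat) (p : R) (G : graph n) : R :=
  \prod_(e : edge n) bernoulli_pmf p (e \in edges G).

Local Open Scope classical_set_scope.

(* The law of G(n, p).  As for [bernoulli_prob], the value outside
   0 <= p <= 1 is a dummy (the point mass at the empty graph), which makes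
   [gnp n p] a probability measure for every real p. *)
Definition gnp (R : realType) (n : nat) (p : R) : set (graph n) -> \bar R :=
  fun A => if 0 <= p <= 1 then (\sum_(G \in A) (gnp_pmf p G)%:E)%E
           else \d_(finset.set0 : graph n) A.
Arguments gnp {R} n p.

Section gnp_probability.
Context {R : realType} (n : nat) (p : R).

Let gnp_pmf_ge0 (G : graph n) : 0 <= p <= 1 -> 0 <= gnp_pmf p G.
Proof. by move=> p01; apply: prodr_ge0 => e _; exact: bernoulli_pmf_ge0. Qed.

Let gnp_pmf_sum1 : \sum_(G : graph n) gnp_pmf p G = 1.
Proof.
transitivity (\prod_(e : edge n) \sum_(b : bool) bernoulli_pmf p b); last first.
  by apply: big1 => e _; rewrite big_bool /= addrC subrK.
rewrite bigA_distr_bigA /=.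
rewrite (reindex (fun f : {ffun edge n -> bool} => [set e | f e]%SET)) /=.
  apply: eq_bigr => f _; apply: eq_bigr => e _.
  by rewrite /edges inE.
exists (fun G : {set edge n} => [ffun e => e \in G]) => [f _|G _].
  by apply/ffunP => e; rewrite ffunE inE.
by apply/setP => e; rewrite inE ffunE.
Qed.

Let gnp0 : gnp n p set0 = 0%E.
Proof. by rewrite /gnp; case: ifPn => // _; rewrite fsbig_set0. Qed.

Let gnp_ge0 A : (0 <= gnp n p A)%E.
Proof.
rewrite /gnp; case: ifPn => // p01; rewrite fsbig_finite//= sumEFin lee_fin.
by apply: sumr_ge0 => G _; exact: gnp_pmf_ge0.
Qed.

Let gnp_sigma_additive : semi_sigma_additive (gnp n p).
Proof.
move=> F mF tF mUF; rewrite /gnp; case: ifPn => p01; last first.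
  exact: measure_semi_sigma_additive.
apply: cvg_toP.
  apply: ereal_nondecreasing_is_cvgn => k m km.
  apply: lee_sum_nneg_natr => // i _ _.
  rewrite fsbig_finite//= sumEFin lee_fin.
  by apply: sumr_ge0 => G _; exact: gnp_pmf_ge0.
transitivity (\sum_(0 <= i <oo) (\esum_(G in F i) (gnp_pmf p G)%:E))%E.
  apply: eq_eseriesr => k _; rewrite esum_fset//= => G _.
  by rewrite lee_fin gnp_pmf_ge0.
rewrite -nneseries_sum_bigcup//=; last first.
  by move=> G; rewrite lee_fin gnp_pmf_ge0.
by rewrite esum_fset//= => G _; rewrite lee_fin gnp_pmf_ge0.
Qed.

HB.instance Definition _ := isMeasure.Build _ _ _ (gnp n p)
  gnp0 gnp_ge0 gnp_sigma_additive.

Let gnp_setT : gnp n p [set: _] = 1%E.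
Proof.
rewrite /gnp; case: ifPn => _; last by rewrite probability_setT.
rewrite fsbig_finite//= sumEFin -gnp_pmf_sum1; congr (_%:E).
apply: perm_big; apply: uniq_perm => [||G].
- exact: fset_uniq.
- exact: index_enum_uniq.
- have finT : finite_set [set: graph n] by exact: finite_finset.
  by rewrite mem_index_enum (in_fset_set finT); exact: asboolT.
Qed.

HB.instance Definition _ :=
  @Measure_isProbability.Build _ _ R (gnp n p) gnp_setT.

End gnp_probability.

Definition subcritical (R : realType) (n : nat) (p : R) : bool :=
  (1 <= n)%N && (0 <= p < n%:R^-1).

(* f = O(a), uniformly in the subcritical range, with an absolute constant. *)
Definition unif_bigO (R : realType) (f a : nat -> R -> R) : Prop :=
  exists C : R, forall (n : nat) (p : R), subcritical n p ->
    `|f n p| <= C * a n p.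

(* X = O_p(a), uniformly in the subcritical range, for random variables
   X n p defined on the probability space of G(n, p). *)
Definition unif_bigOp (R : realType) (X : forall n : nat, R -> graph n -> R)
    (a : nat -> R -> R) : Prop :=
  forall eps : R, 0 < eps -> exists C : R,
    forall (n : nat) (p : R), subcritical n p ->
      (gnp n p [set G | (C * a n p < `|X n p G|)%R] < eps%:E)%E.

(* Convergence in probability to a constant c, for random variables X n
   defined on the (varying) probability spaces of G(n, p n). *)
Definition cvg_in_prob (R : realType) (p : nat -> R)
    (X : forall n : nat, graph n -> R) (c : R) : Prop :=
  forall eps : R, 0 < eps ->
    gnp n (p n) [set G | (eps < `|X n G - c|)%R] @[n --> \oo] --> 0%E.

(* Main.v *)
Require Import Defs.
From mathcomp Require Import all_boot all_order all_algebra.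
From mathcomp Require Import all_classical all_reals all_analysis.
From mathcomp Require Import ring lra.

Import Order.TTheory GRing.Theory Num.Theory.
Import numFieldNormedType.Exports.

Set Implicit Arguments.
Unset Strict Implicit.
Unset Printing Implicit Defensive.

(* For a set F of potential edges, let C_F(v) be the component of v in the
   random graph with edges restricted to F.  Adding an edge vw to F enlarges
   C_F(v) by C_F(w) when vw is present and w is not already in C_F(v); on that
   last event, conditioning on C_F(v) shows that E f(|C_F(v)|) g(|C_F(w)|) is at
   most the product of the expectations, for f, g >= 0 with g nondecreasing.
   With theta = 1 - np, induction on F gives E|C| <= 1/theta,
   E|C|^2 <= 3/theta^3 and E|C|^3 <= 19/theta^5.

   As n chi(G) = sum_v |C(v)|, this bounds E chi from above.  Adding the edges at
   v one at a time gives E|C(v)| >= 1 + p sum_w E[|C(w)|; w not in C(v)]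
   = 1 + p sum_w E|C(w)| - p E|C(v)|^2, and averaging over v bounds E chi from
   below.  In E (n chi)^2 = sum_{v,w} E |C(v)||C(w)|, the pairs in different
   components contribute at most (E n chi)^2 and the others sum_v E|C(v)|^3, so
   Var chi <= 19/(n theta^5).  Finally
   E (theta chi - 1)^2 = theta^2 Var chi + (1 - theta E chi)^2 <= 22/(n theta^3),
   the last square being at most its root since 0 <= theta E chi <= 1, and
   Chebyshev's inequality gives the statements in probability. *)

(** * Components as closed vertex sets, and their dependence on the edge set *)

Section Components.
Import mathcomp.boot.fintype mathcomp.boot.finset.
Variable n : nat.
Local Open Scope set_scope.
Local Open Scope ring_scope.
Implicit Types (G H : {set edge n}) (v w x y : 'I_n) (e : edge n).

Definition component G v : {set 'I_n} := [set x | connect (adj G) v x].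

Lemma adjP G x y :
  reflect (exists2 e, e \in G & val e = [set x; y]) (adj G x y).
Proof.
by apply: (iffP existsP) => -[e]; [case/andP => ? /eqP|move=> eG /eqP exy];
  exists e => //; apply/andP.
Qed.

Lemma edge_ends e v : v \in val e -> exists2 w, w != v & val e = [set v; w].
Proof.
case/cards2P: (valP e) => a [b [ab ->]]; rewrite !inE => /orP[] /eqP ->.
  by exists b => //; rewrite eq_sym.
by exists a => //; rewrite setUC.
Qed.

Lemma edge_adj G e x y : e \in G -> x \in val e -> y \in val e ->
  x = y \/ adj G x y.
Proof.
move=> eG /edge_ends[w wx exw]; rewrite exw !inE => /orP[] /eqP ->; first by left.
by right; apply/adjP; exists e.
Qed.

Lemma adj_sym G : symmetric (adj G).
Proof. by move=> x y; apply/adjP/adjP => -[e eG xy]; exists e; rewrite // setUC. Qed.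

Lemma connect_adj_sym G : connect_sym (adj G).
Proof. exact/sym_connect_sym/adj_sym. Qed.

Lemma component_refl G v : v \in component G v.
Proof. by rewrite inE connect0. Qed.

Lemma component_eq G v x : x \in component G v -> component G x = component G v.
Proof.
rewrite inE => vx; apply/setP => y; rewrite !inE.
exact/esym/(same_connect (connect_adj_sym G)).
Qed.

Lemma component_sym G v x : (x \in component G v) = (v \in component G x).
Proof. by rewrite !inE connect_adj_sym. Qed.

Lemma component_edge G e v x y : e \in G -> x \in val e -> y \in val e ->
  x \in component G v -> y \in component G v.
Proof.
move=> eG xe ye; case: (edge_adj eG xe ye) => [-> //|xy].
by rewrite !inE => vx; apply: connect_trans vx (connect1 xy).
Qed.

Lemma component_min G v (S : {set 'I_n}) : v \in S ->
  (forall e x y, e \in G -> x \in val e -> y \in val e -> x \in S -> y \in S) ->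
  component G v \subset S.
Proof.
move=> vS cS; apply/subsetP => x; rewrite inE => /connectP[s + ->] {x}.
elim: s v vS => //= y s IHs v vS /andP[/adjP[e eG vy] sP].
by apply: IHs sP; apply: cS eG _ _ vS; rewrite vy !inE eqxx ?orbT.
Qed.

Lemma component_mono G H v : G \subset H -> component G v \subset component H v.
Proof.
move=> /subsetP GH; apply: component_min (component_refl _ _) _ => e x y eG.
exact: component_edge (GH _ eG).
Qed.

(** [G] and [H] are compared only on edges meeting [component G v]. This set is closed under [H],
    which gives one inclusion; for the other, its intersection with [component H v] is closed under
    [G]. *)
Lemma component_local G H v :
  (forall e x, x \in val e -> x \in component G v -> (e \in G) = (e \in H)) ->
  component H v = component G v.
Proof.
move=> GH; apply/eqP; rewrite eqEsubset; apply/andP; split.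
  apply: component_min (component_refl _ _) _ => e x y eH xe ye xv.
  by apply: (component_edge _ xe ye xv); rewrite (GH _ _ xe).
suff: component G v \subset component H v :&: component G v.
  by rewrite subsetI => /andP[].
apply: component_min => [|e x y eG xe ye]; rewrite !in_setI ?component_refl//.
move=> /andP[xH xG]; rewrite (component_edge eG xe ye xG) andbT.
by apply: (component_edge _ xe ye xH); rewrite -(GH _ _ xe).
Qed.

Lemma component_setU1 G e v w : val e = [set v; w] ->
  component (e |: G) v = component G v :|: component G w.
Proof.
move=> evw.
have ve : v \in val e by rewrite evw !inE eqxx.
have we : w \in val e by rewrite evw !inE eqxx orbT.
apply/eqP; rewrite eqEsubset; apply/andP; split.
  apply: component_min => [|f x y]; first by rewrite in_setU component_refl.
  rewrite in_setU1 => /orP[/eqP -> _|fG xf yf].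
    rewrite evw in_set2 !in_setU => /orP[] /eqP -> _; rewrite component_refl ?orbT//.
  by rewrite !in_setU => /orP[] /(component_edge fG xf yf) ->; rewrite ?orbT.
have we' : w \in component (e |: G) v.
  by apply: component_edge ve we (component_refl _ _); rewrite setU11.
by rewrite subUset -{2}(component_eq we') !component_mono// subsetU1.
Qed.

Definition touching (S : {set 'I_n}) : {set edge n} :=
  [set e : edge n | ~~ [disjoint val e & S]].

Lemma touchingP (S : {set 'I_n}) e :
  reflect (exists2 x, x \in val e & x \in S) (e \in touching S).
Proof.
rewrite inE; apply: (iffP pred0Pn) => -[x]; first by case/andP; exists x.
by move=> xe xS; exists x; apply/andP.
Qed.

(** Makes the event that the component of [v] is [S] a function of the edges touching [S] alone, as
    [mean_indep] requires. *)
Lemma component_eq_touching G (S : {set 'I_n}) v :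
  (component (G :&: touching S) v == S) = (component G v == S).
Proof.
apply/eqP/eqP => GS; rewrite -[RHS]GS; apply: component_local => e x xe;
  rewrite GS => xS; rewrite in_setI; case: (e \in G) => //=.
  by apply/touchingP; exists x.
by apply/esym/touchingP; exists x.
Qed.

(** A present edge at the component of [w] cannot touch that of [v], so none of these edges is
    deleted. *)
Lemma component_avoid G v w : w \notin component G v ->
  component (G :\: touching (component G v)) w = component G w.
Proof.
move=> wv; apply: component_local => e x xe xw; rewrite in_setD.
case eG: (e \in G); rewrite ?andbF// andbT; apply/esym/touchingP => -[y ye yv].
case/negP: wv; rewrite -(component_eq yv) component_sym.
exact: component_edge eG xe ye xw.
Qed.

Definition star v : {set edge n} := [set e : edge n | v \in val e].

Lemma component_star G v : G :&: star v = set0 -> component G v = [set v].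
Proof.
move=> Gv; apply/eqP; rewrite eqEsubset sub1set component_refl andbT.
apply: component_min => [|e x y eG xe ye]; first by rewrite in_set1.
rewrite !in_set1 => /eqP xv; move: (in_set0 e).
by rewrite -Gv in_setI eG inE -xv xe.
Qed.

Lemma component_setD_star G H v w : G :\: star v \subset H -> H \subset G ->
  w \notin component G v -> component H w = component G w.
Proof.
move=> /subsetP GH /subsetP HG wv; apply: component_local => e x xe xw.
apply/idP/idP => [eG|/HG //]; apply: GH; rewrite in_setD eG andbT inE.
apply: contra wv => ve; rewrite component_sym.
exact: component_edge eG xe ve xw.
Qed.

Lemma card_star v : (#|star v| <= n)%N.
Proof.
rewrite -[leqRHS]card_ord -cardsT.
(* [f] sends an edge at [v] to its other end, which determines the edge; the default [v] is reached
   only for edges off the star. *)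
pose f e := odflt v [pick w | val e == [set v; w]].
suff fK e : e \in star v -> val e = [set v; f e].
  rewrite -(card_in_imset (f := f)) ?subset_leq_card ?subsetT// => e1 e2 e1v e2v.
  by move=> f12; apply/val_inj; rewrite (fK _ e1v) f12 -fK.
rewrite inE /f => /edge_ends[w _ ew].
by case: pickP => [x /eqP //|/(_ w)]; rewrite ew eqxx.
Qed.

(** Each of the $|C|$ vertices of a component $C$ contributes $|C|$. *)
Lemma sum_components (R : nzSemiRingType) G :
  \sum_(C in components G) #|C|%:R ^+ 2 = \sum_v #|component G v|%:R :> R.
Proof.
have eqv : {in [set: 'I_n] & &, equivalence_rel (connect (adj G))}.
  move=> x y z _ _ _; split; first exact: connect0.
  by move=> xy; apply: (same_connect (connect_adj_sym G) xy).
have PT := equivalence_partitionP eqv.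
transitivity (\sum_(v in [set: 'I_n]) #|component G v|%:R : R); last first.
  by apply: eq_bigl => v; rewrite in_setT.
rewrite (set_partition_big _ PT) /=; apply: eq_bigr => C CP.
rewrite (eq_bigr (fun=> #|C|%:R)) => [|v vC]; last first.
  congr _%:R; congr #|pred_of_set _|.
  rewrite -(def_pblock (partition_trivIset PT) CP vC).
  by apply/setP => x; rewrite inE pblock_equivalence_partition ?in_setT.
by rewrite sumr_const expr2 mulr_natr.
Qed.
End Components.

(** * Means over the random graph as finite sums, and independence of disjoint edge sets *)

Section Mean.
Import mathcomp.boot.fintype mathcomp.boot.finset.
Variables (R : realType) (n : nat) (p : R).
Local Open Scope set_scope.
Local Open Scope ring_scope.
Implicit Types (F G H : {set edge n}) (v w x y : 'I_n) (e : edge n).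
Implicit Types (f g : {set edge n} -> R).

(** Stands in for the integral, so that measurability never arises; [expectation_gnp] and [gnpE]
    link it to the measure [gnp]. *)
Definition gnp_mean f : R := \sum_(G : {set edge n}) gnp_pmf p G * f G.
Notation "''E' f" := (gnp_mean f) (at level 10, f at level 8).

Lemma eq_mean f g : f =1 g -> 'E f = 'E g.
Proof. by move=> fg; apply: eq_bigr => G _; rewrite fg. Qed.

Lemma meanD f g : 'E (fun G => f G + g G) = 'E f + 'E g.
Proof. by rewrite -big_split; apply: eq_bigr => G _ /=; rewrite mulrDr. Qed.

Lemma meanZ c f : 'E (fun G => c * f G) = c * 'E f.
Proof. by rewrite mulr_sumr; apply: eq_bigr => G _ /=; rewrite mulrCA. Qed.

Lemma mean_sum (I : finType) (P : pred I) (f : I -> {set edge n} -> R) :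
  'E (fun G => \sum_(i | P i) f i G) = \sum_(i | P i) 'E (f i).
Proof. by rewrite exchange_big; apply: eq_bigr => G _; rewrite mulr_sumr. Qed.

Lemma mean_prod (q : edge n -> bool -> R) :
  'E (fun G => \prod_e q e (e \in G)) =
  \prod_e (p * q e true + (1 - p) * q e false).
Proof.
rewrite bigA_distr; apply: eq_bigr => G _; rewrite -big_split.
by apply: eq_bigr => e _; rewrite /edges /=; case: (e \in G).
Qed.

Lemma mean1 : 'E (fun=> 1) = 1.
Proof.
transitivity ('E (fun G : {set edge n} => \prod_(e : edge n) 1)).
  by apply: eq_mean => G; rewrite big1.
by rewrite [LHS](mean_prod (fun _ _ => 1)) big1// => e _; rewrite !mulr1 addrC subrK.
Qed.

Lemma mean_cst c : 'E (fun=> c) = c.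
Proof. by rewrite -[RHS]mulr1 -mean1 -meanZ; apply: eq_mean => G; rewrite mulr1. Qed.

Lemma mean_mem e : 'E (fun G => (e \in G)%:R) = p.
Proof.
(* As a product over all edges, the indicator falls under [mean_prod], where every factor but the
   one at [e] equals 1. *)
pose q e' b : R := if e' == e then b%:R else 1.
transitivity ('E (fun G : {set edge n} => \prod_e' q e' (e' \in G))).
  apply: eq_mean => G; rewrite (bigD1 e)//= big1 => [|e' /negPf]; rewrite /q.
    by rewrite eqxx mulr1.
  by move=> ->.
rewrite [LHS](mean_prod q) (bigD1 e)//= big1 => [|e' /negPf]; rewrite /q.
  by rewrite eqxx !mulr1 mulr0 addr0.
by move=> ->; rewrite !mulr1 addrC subrK.
Qed.

(* Exchanging the edges outside [F] between two independent copies of the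
   graph turns [f G * g H] into [f G * g G]. *)
Lemma mean_indep F f g : (forall G, f (G :&: F) = f G) ->
  (forall G, g (G :\: F) = g G) -> 'E (fun G => f G * g G) = 'E f * 'E g.
Proof.
move=> fF gF.
pose sw (GH : {set edge n} * {set edge n}) :=
  ((GH.1 :&: F) :|: (GH.2 :\: F), (GH.2 :&: F) :|: (GH.1 :\: F)).
have swK : involutive sw.
  case=> G H; rewrite /sw /=; congr pair; apply/setP => e; rewrite !inE;
  by case: (e \in F); rewrite !(andbT, andbF, orbF).
rewrite -[LHS]mulr1 -mean1 /gnp_mean !big_distrlr /= !pair_big /=.
rewrite [RHS](reindex_inj (can_inj swK)) /=; apply: eq_bigr => -[G H] _ /=.
have -> : f (G :&: F :|: H :\: F) = f G.
  rewrite -fF -(fF G); congr f; apply/setP => e; rewrite !inE.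
  by case: (e \in F); rewrite !(andbT, andbF, orbF).
have -> : g (H :&: F :|: G :\: F) = g G.
  rewrite -gF -(gF G); congr g; apply/setP => e; rewrite !inE.
  by case: (e \in F); rewrite !(andbT, andbF, orbF).
rewrite mulr1 mulrAC -[RHS]mulrACA; congr (_ * _).
(* The exchange preserves the product of the two weights: at each edge outside [F] it merely swaps
   two factors. *)
rewrite /gnp_pmf -!big_split; apply: eq_bigr => e _ /=; rewrite /edges !inE.
by case: (e \in F); rewrite !(andbT, andbF, orbF) // mulrC.
Qed.

Lemma mean_mem_indep e g : (forall G, g (G :\ e) = g G) ->
  'E (fun G => (e \in G)%:R * g G) = p * 'E g.
Proof.
move=> ge; rewrite (mean_indep (F := [set e])) ?mean_mem// => G.
by rewrite in_setI in_set1 eqxx andbT.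
Qed.

Hypothesis p01 : 0 <= p <= 1.

Lemma gnp_pmf_ge0 G : 0 <= gnp_pmf p G.
Proof. by apply: prodr_ge0 => e _; exact: bernoulli_pmf_ge0. Qed.

Lemma mean_ge0 f : (forall G, 0 <= f G) -> 0 <= 'E f.
Proof. by move=> f0; apply: sumr_ge0 => G _; rewrite mulr_ge0 ?gnp_pmf_ge0. Qed.

Lemma mean_le f g : (forall G, f G <= g G) -> 'E f <= 'E g.
Proof. by move=> fg; apply: ler_sum => G _; rewrite ler_wpM2l ?gnp_pmf_ge0. Qed.

Notation size_component F v G := #|component (G :&: F) v|.

(* Conditionally on the component of [v] being [S], the edges off [S] are
   unaffected, and the component of [w] is that in the graph induced off [S]. *)
Lemma mean_disjoint F v w (f g : nat -> R) : (forall k, 0 <= f k) ->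
  (forall k, 0 <= g k) -> {homo g : k l / (k <= l)%N >-> k <= l} ->
  'E (fun G => (w \notin component (G :&: F) v)%:R *
               (f (size_component F v G) * g (size_component F w G)))
  <= 'E (fun G => f (size_component F v G)) *
     'E (fun G => g (size_component F w G)).
Proof.
move=> f0 g0 g_homo.
pose hit (S : {set 'I_n}) G : R := (component (G :&: F) v == S)%:R.
have sum_hit (h : {set 'I_n} -> R) G :
    h (component (G :&: F) v) = \sum_S h S * hit S G.
  rewrite (bigD1 (component (G :&: F) v))//= big1 ?addr0 => [|S /negPf].
    by rewrite /hit eqxx mulr1.
  by rewrite /hit eq_sym => ->; rewrite mulr0.
(* Sorting by the value [S] of the component of [v] makes each term a product of a function of the
   edges touching [S] and a function of the other edges. *)
rewrite (eq_mean (g := fun G => \sum_(S : {set 'I_n}) ((w \notin S)%:R * f #|S|) *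
    (hit S G * g #|component ((G :&: F) :\: touching S) w|))); last first.
  move=> G; rewrite mulrA.
  rewrite (sum_hit (fun S => (w \notin S)%:R * f #|S|)) mulr_suml.
  apply: eq_bigr => S _; rewrite /hit; case: eqP => [<-|_]; last first.
    by rewrite !(mulr0, mul0r).
  case: (boolP (w \in _)) => [|wv]; first by rewrite !mul0r.
  by rewrite component_avoid// !mulrA.
rewrite mean_sum (eq_mean (sum_hit (fun S => f #|S|))) mean_sum mulr_suml.
apply: ler_sum => S _; rewrite !meanZ.
rewrite (mean_indep (F := touching S)).
- have hit0 : 0 <= 'E (hit S) by apply: mean_ge0 => G; rewrite ler0n.
  (* The inequality enters here: the indicator of [w \notin S] is at most 1, and restoring the edges
     touching [S] can only enlarge the component of [w]. *)
  rewrite mulrA ler_pM ?mulr_ge0 ?mean_ge0//.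
  + by rewrite ler_wpM2r // ler_piMl// lern1 leq_b1.
  + apply: mean_le => G; apply/g_homo/subset_leq_card/component_mono.
    by rewrite subsetDl.
- by move=> G; rewrite /hit setIAC component_eq_touching.
- by move=> G; rewrite setIDAC setDDl setUid.
Qed.

Lemma card_component_setU1 G e v w : val e = [set v; w] ->
  #|component (e |: G) v| =
  (#|component G v| + (w \notin component G v) * #|component G w|)%N.
Proof.
move=> evw; rewrite (component_setU1 _ evw).
case: (boolP (w \in _)) => [/component_eq ->|wv]; first by rewrite setUid addn0.
rewrite mul1n -cardsUI -[LHS]addn0; congr addn; apply/esym/eqP.
rewrite cards_eq0; apply: contraNT wv => /set0Pn[x]; rewrite in_setI.
case/andP=> /component_eq <- xw; by rewrite component_sym.
Qed.

(** Since [e] is not in [F], its presence is independent of [G :&: F], hence the factor [p] on the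
    increment of [h]. *)
Lemma mean_component_setU1 F e v w (h : nat -> R) : e \notin F ->
  val e = [set v; w] ->
  'E (fun G => h (size_component (e |: F) v G)) =
  'E (fun G => h (size_component F v G)) +
  p * 'E (fun G => (w \notin component (G :&: F) v)%:R *
    (h (size_component F v G + size_component F w G)%N - h (size_component F v G))).
Proof.
move=> eF evw; rewrite -(mean_mem_indep (e := e)) => [|G]; last first.
  suff -> : (G :\ e) :&: F = G :&: F by [].
  apply/setP => x; rewrite !inE; case: eqP => //= ->.
  by rewrite (negPf eF) !andbF.
rewrite -meanD; apply: eq_mean => G; case: (boolP (e \in G)) => eG.
  have -> : G :&: (e |: F) = e |: (G :&: F).
    by rewrite setIUr; congr setU; apply/setIidPr; rewrite sub1set.
  rewrite (card_component_setU1 _ evw); case: (w \in _) => /=.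
    by rewrite mul0n addn0 !mul0r mulr0 addr0.
  by rewrite mul1n !mul1r addrC subrK.
rewrite mul0r addr0; congr (h #|component _ _|); apply/setP => x.
by rewrite !inE; case: (eqVneq x e) => [->|//]; rewrite (negPf eG).
Qed.

(** * Moments of the component size: the edge recursion and its bounds *)

Definition moment k F v := 'E (fun G => (size_component F v G)%:R ^+ k).

Lemma mean_star F v (h : nat -> R) : F :&: star v = set0 ->
  'E (fun G => h (size_component F v G)) = h 1%N.
Proof.
move=> Fv; rewrite -[RHS]mean_cst; apply: eq_mean => G.
by rewrite component_star ?cards1// -setIA Fv setI0.
Qed.

Lemma moment_ge0 k F v : 0 <= moment k F v.
Proof. by apply: mean_ge0 => G; rewrite exprn_ge0. Qed.

Hypothesis np1 : n%:R * p < 1.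
Let theta := 1 - n%:R * p.

(* The bound proved by induction on [F] is 1 + deg_F(v) p (1 + c) / theta. *)
Lemma edge_recursion_le (M : {set edge n} -> 'I_n -> R) c : 0 <= c ->
  (forall F v, F :&: star v = set0 -> M F v = 1) ->
  (forall F e v w, e \notin F -> val e = [set v; w] ->
    M (e |: F) v <= M F v + p * (c + M F w)) ->
  forall F v, M F v <= (1 + c) / theta.
Proof.
have [p0 _] := andP p01.
have theta0 : 0 < theta by rewrite subr_gt0.
move=> c0 M1 Mstep; set B := (1 + c) / theta.
have B0 : 0 <= B by apply: divr_ge0 (addr_ge0 _ _) (ltW theta0).
(* [B] is the fixed point of the recursion when the degree is replaced by its upper bound [n]. *)
have BE : 1 + c + n%:R * p * B = B.
  by rewrite /B /theta; field; rewrite subr_eq0 gt_eqF.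
have deg_le F v : 1 + #|F :&: star v|%:R * (p * B) + c <= B.
  rewrite -[leRHS]BE addrAC lerD2l -mulrA.
  apply: ler_wpM2r; first exact: mulr_ge0.
  by rewrite ler_nat (leq_trans _ (card_star v))// subset_leq_card// subsetIr.
suff deg_bound F v : M F v <= 1 + #|F :&: star v|%:R * (p * B).
  move=> F v; apply: le_trans (deg_bound F v) _.
  by apply: le_trans (deg_le F v); rewrite lerDl.
(* The induction is on the size of [F], not the degree of [v], because the bound is also needed at
   the other end [w] of the removed edge. *)
have [m] := ubnP #|F|; elim: m F v => // m IHF F v /ltnSE Fm.
have [Fv|[e]] := set_0Vmem (F :&: star v).
  by rewrite M1// Fv cards0 mul0r addr0.
rewrite in_setI inE => /andP[eF ve]; have [w _ evw] := edge_ends ve.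
pose F' := F :\ e; have eF' : e \notin F' by rewrite setD11.
have cardF' : (#|F'| < #|F|)%N by rewrite [ltnRHS](cardsD1 e) eF.
have F'm := leq_trans cardF' Fm.
have FE : F = e |: F' by rewrite setD1K.
have -> : #|F :&: star v| = #|F' :&: star v|.+1.
  rewrite (cardsD1 e) in_setI inE eF ve add1n; congr _.+1.
  by apply: eq_card => x; rewrite !inE andbA.
rewrite {1}FE (le_trans (Mstep _ _ _ _ eF' evw))//.
rewrite -addn1 natrD mulrDl mul1r addrA lerD ?IHF// ler_wpM2l// addrC.
(* By [deg_le], [c + M F' w] is at most [B], so the edge [e] costs at most [p * B]. *)
by apply: le_trans (deg_le F' w); rewrite lerD2r IHF.
Qed.

Lemma moment0 F v : moment 0 F v = 1.
Proof. exact: mean1. Qed.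

Lemma moment_star k F v : F :&: star v = set0 -> moment k F v = 1.
Proof. by move=> Fv; rewrite /moment (mean_star (fun m => m%:R ^+ k))// expr1n. Qed.

Definition cross_moment i j F v w :=
  'E (fun G => (w \notin component (G :&: F) v)%:R *
    ((size_component F v G)%:R ^+ i * (size_component F w G)%:R ^+ j)).

Lemma cross_moment_le i j F v w :
  cross_moment i j F v w <= moment i F v * moment j F w.
Proof.
apply: (mean_disjoint F v w (f := fun m => m%:R ^+ i) (g := fun m => m%:R ^+ j)).
- by move=> k; rewrite exprn_ge0.
- by move=> k; rewrite exprn_ge0.
- by move=> k l kl; rewrite lerXn2r ?nnegrE// ler_nat.
Qed.

Lemma cross_moment_le_bound i j F v w B B' :
  moment i F v <= B -> moment j F w <= B' -> cross_moment i j F v w <= B * B'.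
Proof.
move=> ? ?; apply: le_trans (cross_moment_le _ _ _ _ _) _.
by rewrite ler_pM ?moment_ge0.
Qed.

Lemma cross_moment0_le j F v w : cross_moment 0 j F v w <= moment j F w.
Proof. by rewrite -[leRHS]mul1r -(moment0 F v) cross_moment_le. Qed.

(** Binomial expansion of the increment; the term [i = k] is missing because it cancels the old
    value. *)
Lemma moment_setU1 k F e v w : e \notin F -> val e = [set v; w] ->
  moment k (e |: F) v =
  moment k F v + p * \sum_(i < k) cross_moment i (k - i) F v w *+ 'C(k, i).
Proof.
move=> eF evw; rewrite /moment (mean_component_setU1 (fun m => m%:R ^+ k) eF evw).
congr (_ + p * _).
transitivity (\sum_(i < k) 'C(k, i)%:R * cross_moment i (k - i) F v w); last first.
  by apply: eq_bigr => i _; rewrite mulr_natl.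
under eq_bigr do rewrite -meanZ.
rewrite -mean_sum; apply: eq_mean => G.
rewrite natrD [X in X ^+ k]addrC exprDn big_ord_recr /= subnn expr0 mul1r.
rewrite binn mulr1n addrK mulr_sumr.
apply: eq_bigr => i _; rewrite -mulr_natl; ring.
Qed.

Let theta0 : 0 < theta. Proof. by rewrite subr_gt0. Qed.
Let p0 : 0 <= p. Proof. by case/andP: p01. Qed.
Let theta1 : theta <= 1.
Proof. by rewrite gerBl mulr_ge0. Qed.

Lemma moment1_le F v : moment 1 F v <= 1 / theta.
Proof.
rewrite -[X in X / _]addr0; apply: edge_recursion_le F v => //.
  by move=> F v; exact: moment_star.
move=> F e v w eF evw; rewrite (moment_setU1 _ eF evw) lerD2l ler_wpM2l//.
by rewrite big_ord1 add0r cross_moment0_le.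
Qed.

Lemma moment2_le F v : moment 2 F v <= 3 / theta ^+ 3.
Proof.
(* The recursion is run with $c = 2/\theta^2$, a bound for the cross term $2|C(v)||C(w)|$ from two
   first moments; then $1 + c \le 3/\theta^2$ as $\theta \le 1$. *)
apply: (@le_trans _ _ ((1 + 2 / theta ^+ 2) / theta)); last first.
  have -> : 3 / theta ^+ 3 = (3 / theta ^+ 2) / theta.
    by field; rewrite gt_eqF.
  rewrite ler_pM2r ?invr_gt0//.
  rewrite -subr_ge0.
  have -> : 3 / theta ^+ 2 - (1 + 2 / theta ^+ 2) = (1 - theta ^+ 2) / theta ^+ 2.
    by field; rewrite gt_eqF.
  by rewrite divr_ge0 ?exprn_ge0 ?subr_ge0 ?exprn_ile1// ltW.
apply: edge_recursion_le F v => //.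
- by rewrite divr_ge0// exprn_ge0// ltW.
- by move=> F v; exact: moment_star.
move=> F e v w eF evw; rewrite (moment_setU1 _ eF evw) lerD2l ler_wpM2l//.
rewrite !big_ord_recl big_ord0 /= addr0 addrC lerD ?cross_moment0_le//.
rewrite /bump /= bin1; apply: le_trans (_ : (1 / theta * (1 / theta)) *+ 2 <= _).
  by rewrite lerMn2r cross_moment_le_bound ?moment1_le.
by rewrite le_eqVlt; apply/orP; left; apply/eqP; field; rewrite gt_eqF.
Qed.

Lemma moment3_le F v : moment 3 F v <= 19 / theta ^+ 5.
Proof.
(* Here $c = 18/\theta^4$: two cross terms, each with coefficient 3 and bounded by
   $(1/\theta)(3/\theta^3)$. *)
apply: (@le_trans _ _ ((1 + 18 / theta ^+ 4) / theta)); last first.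
  have -> : 19 / theta ^+ 5 = (19 / theta ^+ 4) / theta.
    by field; rewrite gt_eqF.
  rewrite ler_pM2r ?invr_gt0//.
  rewrite -subr_ge0.
  have -> : 19 / theta ^+ 4 - (1 + 18 / theta ^+ 4) = (1 - theta ^+ 4) / theta ^+ 4.
    by field; rewrite gt_eqF.
  by rewrite divr_ge0 ?exprn_ge0 ?subr_ge0 ?exprn_ile1// ltW.
apply: edge_recursion_le F v => //.
- by rewrite divr_ge0// exprn_ge0// ltW.
- by move=> F v; exact: moment_star.
move=> F e v w eF evw; rewrite (moment_setU1 _ eF evw) lerD2l ler_wpM2l//.
rewrite !big_ord_recl big_ord0 /= addr0 addrC lerD ?cross_moment0_le//.
rewrite /bump /=.
apply: (@le_trans _ _ ((1 / theta * (3 / theta ^+ 3)) *+ 3 +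
                       (3 / theta ^+ 3 * (1 / theta)) *+ 3)).
  by rewrite lerD// lerMn2r cross_moment_le_bound ?moment1_le ?moment2_le ?orbT.
by rewrite le_eqVlt; apply/orP; left; apply/eqP; field; rewrite gt_eqF.
Qed.

(** All edges away from [v] are allowed from the start, so that only the star of [v] grows with
    [W]. *)
Definition joined v (W : {set 'I_n}) : {set edge n} :=
  [set e : edge n | (v \notin val e) || (val e \subset v |: W)].

(* Starting from no edge at [v], the edges joining [v] to [W] are added one by
   one.  Each [w] outside the final component of [v] contributes its own
   component, which avoids the edges at [v]. *)
Lemma moment1_ge_partial v (W : {set 'I_n}) : v \notin W ->
  1 + p * \sum_(w in W) cross_moment 0 1 setT v w <=
  moment 1 (joined v W) v.
Proof.
move=> vW.
have [m] := ubnP #|W|; elim: m W vW => // m IHm W vW /ltnSE Wm.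
have [W0|[w wW]] := set_0Vmem W.
  rewrite W0 big_set0 mulr0 addr0 moment_star//; apply/setP => e.
  rewrite !inE; case: (boolP (v \in val e)) => //= ve; rewrite andbT.
  have [w wv ->] := edge_ends ve; rewrite setU0 subUset !sub1set !inE eqxx.
  exact: negPf.
have wv : w != v by apply: contraNneq vW => <-.
have card_e : #|[set v; w]| == 2 by rewrite cards2 (eq_sym v) wv.
pose e : edge n := exist _ [set v; w] card_e.
pose W' := W :\ w; have W'm : (#|W'| < m)%N.
  by rewrite (leq_trans _ Wm)// [ltnRHS](cardsD1 w) wW.
have vW' : v \notin W' by rewrite in_setD1 negb_and vW orbT.
set F' := joined v W'.
have eF' : e \notin F'.
  rewrite inE negb_or negbK /= !inE eqxx /= subUset !sub1set !inE eqxx /=.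
  by rewrite (negPf wv) eqxx.
have FE : joined v W = e |: F'.
  apply/setP => f; rewrite !inE -val_eqE /=.
  case: (boolP (v \in val f)) => /= [vf|vf]; last by rewrite orbT.
  have [x xv ->] := edge_ends vf; rewrite !subUset !sub1set !inE eqxx /=.
  rewrite (negPf xv) /=; case: (eqVneq x w) => [->|xw] /=; first by rewrite eqxx.
  case: eqP => // /setP/(_ x); rewrite !inE eqxx orbT (negPf xv) (negPf xw).
  by [].
rewrite FE (moment_setU1 (v := v) (w := w) 1 eF' erefl) (big_setD1 w)//=.
rewrite mulrDr addrCA addrC lerD ?IHm// ler_wpM2l// big_ord1.
apply: mean_le => G; rewrite !expr1 !expr0 !mul1r setIT.
case: (boolP (w \in component G v)) => [|wG]; first by rewrite mul0r mulr_ge0.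
(* If [w] is missed in the full graph, it is missed at the current stage too, and its component is
   then the same in both graphs. *)
have FG : component (G :&: F') v \subset component G v.
  by apply: component_mono; rewrite subsetIl.
rewrite (contra (subsetP FG w))// !mul1r ler_nat.
rewrite (component_setD_star (G := G) (v := v) (H := G :&: F'))//.
  by apply/subsetP => f; rewrite !inE => /andP[-> ->].
by rewrite subsetIl.
Qed.

Lemma moment1_ge v :
  1 + p * \sum_w moment 1 setT w <= moment 1 setT v + p * moment 2 setT v.
Proof.
(* The vertices [w] inside $C(v)$ contribute $|C(v)|$ each, hence $|C(v)|^2$ in total. *)
have -> : \sum_w moment 1 setT w =
    \sum_w cross_moment 0 1 setT v w + moment 2 setT v.
  rewrite -!mean_sum -meanD; apply: eq_mean => G; rewrite setIT.
  have -> : #|component G v|%:R ^+ 2 =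
      \sum_(w in component G v) #|component G v|%:R :> R.
    by rewrite sumr_const expr2 mulr_natr.
  rewrite [X in _ + X]big_mkcond -big_split.
  apply: eq_bigr => w _ /=; case: (boolP (w \in _)) => [wv|wv].
    by rewrite mul0r add0r ?setIT expr1 (component_eq wv).
  by rewrite !mul1r addr0.
rewrite mulrDr addrA lerD2r.
have := moment1_ge_partial (v := v) (W := [set~ v]).
rewrite !inE eqxx => /(_ isT).
have -> : joined v [set~ v] = setT.
  by apply/setP => e; rewrite !inE setUCr subsetT orbT.
rewrite (eq_bigl (predC1 v)) => [|w]; last by rewrite !inE.
(* The term [w = v] vanishes, since [v] lies in its own component. *)
rewrite [X in _ -> _ + _ * X <= _](bigD1 v)//=.
rewrite [X in _ -> _ + _ * (X + _) <= _](_ : _ = 0) ?add0r//.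
rewrite /cross_moment -[RHS](mean_cst 0); apply: eq_mean => G.
by rewrite component_refl mul0r.
Qed.

Lemma mean_sum_component_sqr :
  'E (fun G => (\sum_v #|component G v|%:R) ^+ 2) <=
  \sum_v moment 3 setT v + (\sum_v moment 1 setT v) ^+ 2.
Proof.
have E2 G : (\sum_v #|component G v|%:R) ^+ 2 =
  \sum_v #|component (G :&: setT) v|%:R ^+ 3 +
  \sum_v \sum_w ((w \notin component (G :&: setT) v)%:R *
     (#|component (G :&: setT) v|%:R ^+ 1 *
      #|component (G :&: setT) w|%:R ^+ 1)) :> R.
  rewrite setIT expr2 big_distrlr /= -big_split; apply: eq_bigr => v _ /=.
  (* Pairs are split by whether [w] lies in $C(v)$; for fixed [v], those inside give $|C(v)|$ times
     $|C(v)|^2$. *)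
  have -> : #|component G v|%:R ^+ 3 =
      \sum_(w in component G v) #|component G v|%:R ^+ 2 :> R.
    by rewrite sumr_const exprSr mulr_natr.
  rewrite [X in _ = X + _]big_mkcond -big_split; apply: eq_bigr => w _ /=.
  case: (boolP (w \in _)) => [wv|wv]; last by rewrite add0r mul1r !expr1.
  by rewrite mul0r addr0 (component_eq wv) expr2.
rewrite (eq_mean E2) meanD mean_sum lerD2l mean_sum expr2 big_distrlr /=.
apply: ler_sum => v _; rewrite mean_sum; apply: ler_sum => w _.
exact: cross_moment_le.
Qed.

End Mean.

Local Open Scope classical_set_scope.
Local Open Scope ring_scope.

(** * From finite sums to expectation, variance and probability under [gnp] *)

Section Law.
Variables (R : realType) (n : nat) (p : R).
Hypothesis p01 : 0 <= p <= 1.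

Lemma expectation_gnp (f : graph n -> R) : (forall G, 0 <= f G) ->
  ('E_(gnp n p)[f] = (gnp_mean p f)%:E)%E.
Proof.
move=> f0; have mT (A : set (graph n)) : measurable A by [].
rewrite unlock.
rewrite (eq_integral (fun G =>
    \sum_(H : graph n) (f H)%:E * (\1_[set H] G)%:E)%E); last first.
  move=> G _; rewrite (bigD1 G)//= big1 => [|H HG].
    by rewrite indicE in_set1 eqxx mule1 adde0.
  by rewrite indicE in_set1 eq_sym (negPf HG) mule0.
rewrite ge0_integral_sum//=; last by move=> H G _; rewrite mule_ge0// lee_fin.
rewrite /gnp_mean -sumEFin; apply: eq_bigr => H _.
rewrite ge0_integralZl_EFin//.
have gnp1 : gnp n p [set H] = (gnp_pmf p H)%:E by rewrite /gnp p01 fsbig_set1.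
rewrite integral_indic// setIT muleC EFinM; congr (_ * _)%E.
exact: gnp1.
Qed.

Lemma gnpE (A : set (graph n)) : gnp n p A = (gnp_mean p \1_A)%:E.
Proof.
rewrite -expectation_gnp => [|G]; last by rewrite indicE.
by rewrite unlock integral_indic// setIT.
Qed.

Lemma mean_sqrB (f : graph n -> R) c :
  gnp_mean p (fun G => (f G - c) ^+ 2) =
  gnp_mean p (fun G => f G ^+ 2) - 2 * c * gnp_mean p f + c ^+ 2.
Proof.
rewrite -mulNr -meanZ -meanD -[c ^+ 2 in RHS](mean_cst n p) -meanD.
by apply: eq_mean => G; ring.
Qed.

(** The indicator is at most $X^2/c^2$ pointwise. The second moment is uncentred, so bias and
    variance can be handled together. *)
Lemma gnp_chebyshev (X : graph n -> R) c : 0 < c ->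
  (gnp n p [set G | (c < `|X G|)%R] <=
   (gnp_mean p (fun G => X G ^+ 2) / c ^+ 2)%:E)%E.
Proof.
move=> c0; rewrite gnpE lee_fin mulrC -meanZ; apply: mean_le => // G.
rewrite indicE; case: (boolP (G \in _)) => [|_]; last first.
  by rewrite mulr_ge0 ?invr_ge0 ?sqr_ge0.
rewrite inE /= => cX; rewrite mulrC ler_pdivlMr ?exprn_gt0// mul1r.
by rewrite -[leRHS]real_normK ?num_real// lerXn2r ?nnegrE ?ltW// (lt_trans c0).
Qed.

Lemma variance_gnp (f : graph n -> R) : (forall G, 0 <= f G) ->
  'V_(gnp n p)[f] =
  (gnp_mean p (fun G => f G ^+ 2) - gnp_mean p f ^+ 2)%:E.
Proof.
move=> f0; rewrite /variance covariance.unlock (expectation_gnp f0) /=.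
rewrite expectation_gnp => [|G]; last by rewrite -expr2 sqr_ge0.
congr EFin; transitivity (gnp_mean p (fun G => (f G - gnp_mean p f) ^+ 2)).
  by apply: eq_mean => G; rewrite expr2.
by rewrite mean_sqrB; ring.
Qed.

End Law.

(** * Mean, variance and mean square error of the susceptibility *)

Section Susceptibility.
Variables (R : realType) (n : nat) (p : R).
Hypothesis sub : subcritical n p.
Let theta := 1 - n%:R * p.
Let chi := @susceptibility R n.

Let n0 : 0 < n%:R :> R.
Proof. by case/andP: sub => n1 _; rewrite ltr0n. Qed.

Let p0 : 0 <= p. Proof. by case/andP: sub => _ /andP[]. Qed.

Let pn : p < n%:R^-1. Proof. by case/andP: sub => _ /andP[]. Qed.

Lemma subcritical_prob : 0 <= p <= 1.
Proof.
rewrite p0 (le_trans (ltW pn))// invf_le1//.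
by case/andP: sub => n1 _; rewrite ler1n.
Qed.

Lemma subcritical_mean_degree : n%:R * p < 1.
Proof. by rewrite mulrC -ltr_pdivlMr// mul1r. Qed.

Let theta0 : 0 < theta. Proof. by rewrite subr_gt0 subcritical_mean_degree. Qed.

Lemma susceptibilityE G : chi G = n%:R^-1 * \sum_v #|component G v|%:R.
Proof. by rewrite /chi /susceptibility sum_components. Qed.

Lemma susceptibility_ge0 G : 0 <= chi G.
Proof. by rewrite susceptibilityE mulr_ge0 ?invr_ge0 ?sumr_ge0// ltW. Qed.

Lemma mean_susceptibility :
  gnp_mean p chi = n%:R^-1 * \sum_v moment p 1 [set: edge n]%SET v.
Proof.
rewrite -mean_sum -meanZ; apply: eq_mean => G; rewrite susceptibilityE.
by congr (_ * _); apply: eq_bigr => v _; rewrite finset.setIT.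
Qed.

Lemma sum_le_cst (f : 'I_n -> R) c : (forall v, f v <= c) ->
  n%:R^-1 * \sum_v f v <= c.
Proof.
move=> fc; rewrite mulrC ler_pdivrMr//.
apply: (le_trans (ler_sum (G := fun=> c) _ _)) => //.
by rewrite sumr_const card_ord mulr_natr.
Qed.

Lemma mean_susceptibility_le : theta * gnp_mean p chi <= 1.
Proof.
rewrite mulrC -ler_pdivlMr// mean_susceptibility.
by apply: sum_le_cst => v; apply: moment1_le;
  [exact: subcritical_prob|exact: subcritical_mean_degree].
Qed.

(** Averaging [moment1_ge] over [v] gives $m \ge 1 + npm - 3p/\theta^3$ for the mean $m$, and $p <
    1/n$. *)
Lemma mean_susceptibility_ge :
  1 - 3 / (n%:R * theta ^+ 3) <= theta * gnp_mean p chi.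
Proof.
have M1 v : 1 + p * (n%:R * gnp_mean p chi) - 3 / (n%:R * theta ^+ 3) <=
    moment p 1 [set: edge n]%SET v.
  rewrite mean_susceptibility mulVKf ?gt_eqF// lerBlDr.
  apply: le_trans (moment1_ge subcritical_prob v) _.
  rewrite lerD2l (_ : 3 / _ = n%:R^-1 * (3 / theta ^+ 3)); last first.
    by field; rewrite !gt_eqF.
  rewrite ler_pM ?moment_ge0 ?subcritical_prob ?(ltW pn)//.
  by apply: moment2_le; [exact: subcritical_prob|exact: subcritical_mean_degree].
set c := 3 / _ in M1 *.
have : \sum_(v < n) (1 + p * (n%:R * gnp_mean p chi) - c)
    <= \sum_v moment p 1 [set: edge n]%SET v by apply: ler_sum => v _.
rewrite sumr_const card_ord -[X in X <= _]mulr_natl -ler_pdivlMl//.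
by rewrite -mean_susceptibility /theta; lra.
Qed.

Lemma variance_susceptibility_le :
  gnp_mean p (fun G => chi G ^+ 2) - gnp_mean p chi ^+ 2
  <= 19 / (n%:R * theta ^+ 5).
Proof.
rewrite lerBlDr.
have -> : gnp_mean p (fun G => chi G ^+ 2) =
    n%:R^-1 ^+ 2 * gnp_mean p (fun G => (\sum_(v < n) #|component G v|%:R) ^+ 2).
  by rewrite -meanZ; apply: eq_mean => G; rewrite susceptibilityE exprMn.
rewrite mean_susceptibility exprMn.
apply: le_trans (ler_wpM2l _ (mean_sum_component_sqr n subcritical_prob)) _.
  by rewrite exprn_ge0// invr_ge0 ltW.
(* The squared sum of first moments cancels against the squared mean, leaving only the third
   moments. *)
rewrite mulrDr lerD2r expr2 -mulrA.
rewrite (_ : 19 / _ = n%:R^-1 * (19 / theta ^+ 5)); last by field; rewrite !gt_eqF.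
rewrite ler_pM2l ?invr_gt0//; apply: sum_le_cst => v.
by apply: moment3_le; [exact: subcritical_prob|exact: subcritical_mean_degree].
Qed.

Lemma mean_sqr_susceptibility_error_le :
  gnp_mean p (fun G => (theta * chi G - 1) ^+ 2) <= 22 / (n%:R * theta ^+ 3).
Proof.
set m := gnp_mean p chi.
have -> : gnp_mean p (fun G => (theta * chi G - 1) ^+ 2) =
    theta ^+ 2 * (gnp_mean p (fun G => chi G ^+ 2) - m ^+ 2) + (theta * m - 1) ^+ 2.
  rewrite mean_sqrB (meanZ _ _ chi) -/m.
  under eq_mean do rewrite exprMn.
  by rewrite meanZ; ring.
(* 22 = 19 + 3, from the variance and the squared bias. *)
rewrite (_ : 22 / _ = theta ^+ 2 * (19 / (n%:R * theta ^+ 5)) +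
    3 / (n%:R * theta ^+ 3)); last first.
  by field; rewrite !gt_eqF.
apply: lerD; first by rewrite ler_wpM2l ?sqr_ge0 ?variance_susceptibility_le.
have m0 : 0 <= theta * m.
  by rewrite mulr_ge0 ?mean_ge0 ?subcritical_prob// ?(ltW theta0)// => G;
    exact: susceptibility_ge0.
have := mean_susceptibility_le; have := mean_susceptibility_ge; rewrite -/m.
nra.
Qed.

End Susceptibility.

(** * Fractional powers and the final estimates *)

Lemma powR_inv_sqrt_sqr (R : realType) (x : R) : 0 < x ->
  (x `^ (- (1 / 2))) ^+ 2 = x^-1.
Proof.
move=> x0; rewrite -powR_mulrn ?powR_ge0// -powRrM mulNr mul1r mulVf//.
by rewrite powR_inv1// ltW.
Qed.

Lemma powR_cbrt_cube (R : realType) (x : R) : 0 <= x ->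
  (x `^ (1 / 3)) ^+ 3 = x.
Proof.
move=> x0; rewrite -powR_mulrn ?powR_ge0// -powRrM mul1r mulVf//.
by rewrite powRr1.
Qed.

Theorem theorem1p1 (R : realType) :
  (exists2 delta : nat -> R -> R,
     unif_bigO delta (fun n p => 1 / (n%:R * (1 - n%:R * p) ^+ 3)) &
     forall (n : nat) (p : R), subcritical n p ->
       ('E_(gnp n p)[@susceptibility R n] =
          (1 / (1 - n%:R * p) * (1 + delta n p))%:E)%E) /\
  (exists2 v : nat -> R -> R,
     unif_bigO v (fun n p => 1 / (n%:R * (1 - n%:R * p) ^+ 5)) &
     forall (n : nat) (p : R), subcritical n p ->
       ('V_(gnp n p)[@susceptibility R n] = (v n p)%:E)%E) /\
  (exists2 X : forall n : nat, R -> graph n -> R,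
     unif_bigOp X
       (fun n p => (n%:R * (1 - n%:R * p) ^+ 3) `^ (- (1 / 2))) &
     forall (n : nat) (p : R), subcritical n p -> forall G : graph n,
       susceptibility R G = 1 / (1 - n%:R * p) * (1 + X n p G)) /\
  (forall p : nat -> R,
     (forall n : nat, (1 <= n)%N -> 0 <= p n < n%:R^-1) ->
     n%:R `^ (1 / 3) * (1 - n%:R * p n) @[n --> \oo] --> +oo ->
     cvg_in_prob p
       (fun n (G : graph n) => (1 - n%:R * p n) * susceptibility R G) 1).
Proof.
have pos n (p : R) : subcritical n p -> 0 < n%:R :> R /\ 0 < 1 - n%:R * p.
  move=> sub; split; first by case/andP: sub; rewrite ltr0n.
  by rewrite subr_gt0 subcritical_mean_degree.
split; [|split; [|split]].
- exists (fun n p => (1 - n%:R * p) * gnp_mean p (@susceptibility R n) - 1).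
    exists 3 => n p sub; rewrite mul1r.
    have := mean_susceptibility_le sub; have := mean_susceptibility_ge sub.
    have [n0 th0] := pos _ _ sub.
    by move=> lo hi; rewrite ler_norml; apply/andP; split; [lra|];
      rewrite (@le_trans _ _ 0)// ?subr_le0// divr_ge0 ?mulr_ge0 ?exprn_ge0// ltW.
  move=> n p sub; have [n0 th0] := pos _ _ sub.
  rewrite (expectation_gnp (subcritical_prob sub)) => [|G]; last first.
    exact: susceptibility_ge0.
  by congr EFin; field; rewrite gt_eqF.
(* The centred form of the variance is visibly nonnegative, which removes the absolute value. *)
- exists (fun n p => gnp_mean p (fun G => (@susceptibility R n G -
    gnp_mean p (@susceptibility R n)) ^+ 2)).
    exists 19 => n p sub; have p01 := subcritical_prob sub.
    rewrite mul1r ger0_norm; last by apply: mean_ge0 => // G; exact: sqr_ge0.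
    apply: le_trans (variance_susceptibility_le sub).
    by rewrite mean_sqrB le_eqVlt; apply/orP; left; apply/eqP; ring.
  move=> n p sub; rewrite (variance_gnp (subcritical_prob sub)) => [|G]; last first.
    exact: susceptibility_ge0.
  by congr EFin; rewrite mean_sqrB; ring.
- exists (fun n p G => (1 - n%:R * p) * @susceptibility R n G - 1); last first.
    move=> n p sub G; have [_ th0] := pos _ _ sub.
    by field; rewrite gt_eqF.
  (* Chebyshev's inequality leaves $22/C^2 < \varepsilon$ to prove; the added 1 gives both $C >
     22/\varepsilon$ and $C \ge 1$, so $C^2 \ge C$ suffices. *)
  move=> eps eps0; exists (22 / eps + 1) => n p sub.
  set C := 22 / eps + 1.
  have C1 : 1 <= C by rewrite lerDr divr_ge0// ltW.
  have [n0 th0] := pos _ _ sub.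
  set N := n%:R * _; have N0 : 0 < N by rewrite mulr_gt0 ?exprn_gt0.
  have a0 : 0 < C * N `^ (- (1 / 2)).
    by rewrite mulr_gt0 ?powR_gt0// (lt_le_trans ltr01).
  apply: le_lt_trans (gnp_chebyshev (subcritical_prob sub) _ a0) _.
  rewrite lte_fin exprMn powR_inv_sqrt_sqr// ltr_pdivrMr; last first.
    by rewrite mulr_gt0 ?invr_gt0// exprn_gt0// (lt_le_trans ltr01).
  apply: le_lt_trans (mean_sqr_susceptibility_error_le sub) _.
  rewrite -/N mulrA ltr_pM2r ?invr_gt0// mulrC -ltr_pdivrMr//.
  by rewrite (@lt_le_trans _ _ C) ?ltrDl// expr2 ler_peMl// (le_trans ler01).
- move=> p psub /cvgryPge pinf eps eps0; apply/fine_cvgP; split.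
    by near=> n; exact: fin_num_measure.
  apply/cvgrPdist_lt => eta eta0; near=> n.
  have n1 : (1 <= n)%N by near: n; exists 1%N.
  have sub : subcritical n (p n) by rewrite /subcritical n1 psub.
  have [n0 th0] := pos _ _ sub.
  set M := n%:R `^ (1 / 3) * (1 - n%:R * p n).
  (* Chebyshev's bound is $22/(\varepsilon^2 M^3)$; since $M \ge 1$ gives $M^3 \ge M$, this
     threshold brings it below [eta]. *)
  have M1 : 1 + 22 / (eps ^+ 2 * eta) <= M.
    by rewrite /M; near: n; exact: pinf.
  have eta22 : 0 <= 22 / (eps ^+ 2 * eta).
    by rewrite divr_ge0 ?mulr_ge0 ?exprn_ge0 ?ltW.
  have NE : n%:R * (1 - n%:R * p n) ^+ 3 = M ^+ 3.
    by rewrite /M exprMn powR_cbrt_cube// ltW.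
  have M1' : 1 <= M by rewrite (le_trans _ M1)// lerDl.
  have MM : M <= M ^+ 3 by rewrite exprS ler_peMr ?exprn_ege1// (le_trans ler01).
  pose X (G : graph n) := (1 - n%:R * p n) * susceptibility R G - 1.
  have PE := gnpE (subcritical_prob sub) [set G | (eps < `|X G|)%R].
  have H := gnp_chebyshev (subcritical_prob sub) X eps0.
  rewrite PE lee_fin in H.
  rewrite sub0r normrN /= [X in `|X|](congr1 fine PE) ger0_norm; last first.
    by apply: (mean_ge0 (subcritical_prob sub)) => G; exact: ler0n.
  apply: le_lt_trans H _; rewrite ltr_pdivrMr ?exprn_gt0//.
  apply: le_lt_trans (mean_sqr_susceptibility_error_le sub) _.
  rewrite NE ltr_pdivrMr ?(lt_le_trans _ (le_trans M1' MM))//.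
  apply: (@lt_le_trans _ _ (eta * eps ^+ 2 * M)); last first.
    by rewrite ler_wpM2l// mulr_ge0 ?exprn_ge0 ?ltW.
  rewrite mulrC -ltr_pdivrMr ?mulr_gt0 ?exprn_gt0// (mulrC eta).
  by rewrite (lt_le_trans _ M1)// ltrDr.
Unshelve. all: by end_near.
Qed.
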